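(* For any $\mathcal{L}_{\mathrm{RBL}}$-formulae $A$ and $B$, if $\top\Rightarrow A\vee B$ is derivable in $\mathsf{L_{RBL}}$, then $\top\Rightarrow A$ or $\top\Rightarrow B$ is derivable in $\mathsf{L_{RBL}}$.
   Context: $\mathcal{L}_{\mathrm{RBL}}$-formulae are built from propositional letters by $\bot,\top,\wedge,\vee,\cdot,\rightarrow,\leftarrow$. $\mathsf{L_{RBL}}$ is the sequent calculus for sequents $\Gamma\Rightarrow A$ over formula structures built with $\odot$ (structural $\cdot$) and $\mathbin{\bar{\wedge}}$ (structural $\wedge$): axioms $A\Rightarrow A$, $A\Rightarrow\top$, $\bot\Rightarrow A$; left/right rules for $\rightarrow,\leftarrow,\cdot,\wedge,\vee$ (with $(\vee R)$: from $\Gamma\Rightarrow A_i$ infer $\Gamma\Rightarrow A_1\vee A_2$); contraction, exchange, associativity for $\mathbin{\bar{\wedge}}$; restricted $\odot$-contraction from $\Gamma[(\Lambda\odot\Delta)\odot\Delta]\Rightarrow A$ to $\Gamma[\Lambda\odot\Delta]\Rightarrow A$ ($\Lambda$ nonempty); weakening for $\odot$ and $\mathbin{\bar{\wedge}}$; Cut. Cut (equivalently the Mix rule) is eliminable except when the cut formula is $\bot$ or $\top$. *)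

(* Defs.v *)
Set Implicit Arguments.

Section Language.

Variable V : Type.

Inductive formula : Type :=
| Var : V -> formula
| Bot : formula
| Top : formula
| And : formula -> formula -> formula
| Or : formula -> formula -> formula
| Prod : formula -> formula -> formula
| RImp : formula -> formula -> formula  (* [RImp A B] is A → B *)
| LImp : formula -> formula -> formula. (* [LImp B A] is B ← A *)

(** There is no empty structure, so the side condition that Λ is nonempty in
    restricted ⊙-contraction always holds. *)
Inductive structure : Type :=
| SForm : formula -> structure
| SProd : structure -> structure -> structure  (* ⊙ *)
| SAnd : structure -> structure -> structure.  (* structural ∧ *)

(** Structures with exactly one hole, the Γ[-] of the rules. *)
Inductive context : Type :=
| Hole : context
| CProdL : context -> structure -> context
| CProdR : structure -> context -> context
| CAndL : context -> structure -> context
| CAndR : structure -> context -> context.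

Fixpoint plug (G : context) (D : structure) : structure :=
  match G with
  | Hole => D
  | CProdL G' E => SProd (plug G' D) E
  | CProdR E G' => SProd E (plug G' D)
  | CAndL G' E => SAnd (plug G' D) E
  | CAndR E G' => SAnd E (plug G' D)
  end.

End Language.

Arguments Bot {V}.
Arguments Top {V}.
Arguments Hole {V}.

Declare Scope rbl_scope.
Delimit Scope rbl_scope with rbl.
Open Scope rbl_scope.

Notation "⊥" := Bot : rbl_scope.
Notation "⊤" := Top : rbl_scope.
Notation "A ⋅ B" := (Prod A B) (at level 40, left associativity) : rbl_scope.
Notation "A ∧' B" := (And A B) (at level 50, left associativity) : rbl_scope.
Notation "A ∨' B" := (Or A B) (at level 55, left associativity) : rbl_scope.
Notation "A →' B" := (RImp A B) (at level 60, right associativity) : rbl_scope.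
Notation "B ←' A" := (LImp B A) (at level 60, no associativity) : rbl_scope.
Notation "$ A" := (SForm A) (at level 30, right associativity) : rbl_scope.
Notation "X ⊙ Y" := (SProd X Y) (at level 65, left associativity) : rbl_scope.
Notation "X ⊼ Y" := (SAnd X Y) (at level 65, left associativity) : rbl_scope.
Notation "G [[ D ]]" := (plug G D) (at level 10, D at level 69) : rbl_scope.

Reserved Notation "X ⇒ A" (at level 70, no associativity).

(** [→] is the right residual and [←] the left residual of [⋅]:
    A ⋅ B ⇒ C  iff  B ⇒ A → C  iff  A ⇒ C ← B. *)
Inductive derivable {V : Type} : structure V -> formula V -> Prop :=
| Id A : $A ⇒ A
| TopAx A : $A ⇒ ⊤
| BotAx A : $⊥ ⇒ A

| RImp_L G D A B C :
    D ⇒ A -> G[[ $B ]] ⇒ C -> G[[ D ⊙ $(A →' B) ]] ⇒ C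
| RImp_R X A B :
    $A ⊙ X ⇒ B -> X ⇒ A →' B
| LImp_L G D A B C :
    D ⇒ A -> G[[ $B ]] ⇒ C -> G[[ $(B ←' A) ⊙ D ]] ⇒ C
| LImp_R X A B :
    X ⊙ $A ⇒ B -> X ⇒ B ←' A
| Prod_L G A B C :
    G[[ $A ⊙ $B ]] ⇒ C -> G[[ $(A ⋅ B) ]] ⇒ C
| Prod_R X Y A B :
    X ⇒ A -> Y ⇒ B -> X ⊙ Y ⇒ A ⋅ B
| And_L G A B C :
    G[[ $A ⊼ $B ]] ⇒ C -> G[[ $(A ∧' B) ]] ⇒ C
| And_R X Y A B :
    X ⇒ A -> Y ⇒ B -> X ⊼ Y ⇒ A ∧' B
| Or_L G A B C :
    G[[ $A ]] ⇒ C -> G[[ $B ]] ⇒ C -> G[[ $(A ∨' B) ]] ⇒ C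
| Or_R1 X A B :
    X ⇒ A -> X ⇒ A ∨' B
| Or_R2 X A B :
    X ⇒ B -> X ⇒ A ∨' B

| SAnd_contr G D A :
    G[[ D ⊼ D ]] ⇒ A -> G[[ D ]] ⇒ A
| SAnd_exch G D E A :
    G[[ D ⊼ E ]] ⇒ A -> G[[ E ⊼ D ]] ⇒ A
| SAnd_assoc1 G D E F A :
    G[[ (D ⊼ E) ⊼ F ]] ⇒ A -> G[[ D ⊼ (E ⊼ F) ]] ⇒ A
| SAnd_assoc2 G D E F A :
    G[[ D ⊼ (E ⊼ F) ]] ⇒ A -> G[[ (D ⊼ E) ⊼ F ]] ⇒ A
| SAnd_weak G D E A :
    G[[ D ]] ⇒ A -> G[[ D ⊼ E ]] ⇒ A
| SProd_contr G L D A :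
    G[[ (L ⊙ D) ⊙ D ]] ⇒ A -> G[[ L ⊙ D ]] ⇒ A
| SProd_weak_r G D E A :
    G[[ D ]] ⇒ A -> G[[ D ⊙ E ]] ⇒ A
| SProd_weak_l G D E A :
    G[[ D ]] ⇒ A -> G[[ E ⊙ D ]] ⇒ A

| Cut G D A B :
    D ⇒ A -> G[[ $A ]] ⇒ B -> G[[ D ]] ⇒ B

where "X ⇒ A" := (derivable X A) : rbl_scope.

(* Main.v *)
(** Adjoin a new top element 1 to the Lindenbaum algebra, with products computed
    after collapsing 1 to ⊤, so that a product is never 1. The result is again a
    model, and 1 is join-irreducible in it. [reaches_top A] says that [A], with
    letters sent to their own classes, takes the value 1; collapsing 1 then
    gives ⊤ ⇒ A. *)
Require Import Defs.

Fixpoint reaches_top {V : Type} (A : formula V) : Prop :=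
  match A with
  | Var _ | Bot | Prod _ _ => False
  | Top => True
  | And A B => reaches_top A /\ reaches_top B
  | Or A B => reaches_top A \/ reaches_top B
  | RImp A B => $⊤ ⇒ A →' B
  | LImp B A => $⊤ ⇒ B ←' A
  end.

Fixpoint sreaches_top {V : Type} (X : structure V) : Prop :=
  match X with
  | SForm A => reaches_top A
  | SProd _ _ => False
  | SAnd X Y => sreaches_top X /\ sreaches_top Y
  end.

Fixpoint context_comp {V : Type} (G H : context V) : context V :=
  match G with
  | Hole => H
  | CProdL G' E => CProdL (context_comp G' H) E
  | CProdR E G' => CProdR E (context_comp G' H)
  | CAndL G' E => CAndL (context_comp G' H) E
  | CAndR E G' => CAndR E (context_comp G' H)
  end.

Lemma plug_comp (V : Type) (G H : context V) (D : structure V) :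
  plug (context_comp G H) D = plug G (plug H D).
Proof. induction G; simpl; congruence. Qed.

Lemma reaches_top_derivable (V : Type) (A : formula V) :
  reaches_top A -> $⊤ ⇒ A.
Proof.
  induction A; simpl; intros H; try contradiction; try assumption.
  - apply Id.
  - destruct H as [H1 H2].
    apply (SAnd_contr Hole); simpl; apply And_R; auto.
  - destruct H; [apply Or_R1 | apply Or_R2]; auto.
Qed.

(** Cut settles a single formula. For [⊼], contraction reduces [⊤] to [⊤ ⊼ ⊤], whose halves are
    exchanged one at a time, each in a larger context; hence the quantifier over [G]. *)
Lemma sreaches_top_plug_top (V : Type) (X : structure V) :
  sreaches_top X ->
  forall (G : context V) (A : formula V), plug G X ⇒ A -> plug G ($⊤) ⇒ A.
Proof.
  induction X as [B | X IHX Y IHY | X IHX Y IHY]; simpl; intros HX G A H.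
  - exact (Cut G (reaches_top_derivable _ _ HX) H).
  - contradiction.
  - destruct HX as [HX HY].
    apply SAnd_contr.
    specialize (IHX HX (context_comp G (CAndL Hole Y)) A).
    specialize (IHY HY (context_comp G (CAndR ($⊤) Hole)) A).
    rewrite !plug_comp in IHX, IHY; simpl in IHX, IHY; auto.
Qed.

(** The hypothesis excludes [⊙] above the hole, so the path to it crosses only [⊼]. *)
Lemma sreaches_top_plug (V : Type) (G : context V) (D : structure V) :
  sreaches_top (plug G D) ->
  sreaches_top D /\
  forall E : structure V, sreaches_top E -> sreaches_top (plug G E).
Proof. induction G; simpl; firstorder. Qed.

Lemma reaches_top_sound (V : Type) (X : structure V) (A : formula V) :
  X ⇒ A -> sreaches_top X -> reaches_top A.
Proof.
  induction 1; intros HX; simpl in HX |- *;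
    try (apply sreaches_top_plug in HX; destruct HX as [HD HG]; simpl in HD);
    (* Left rules and structural rules with [⊙] at the hole of the conclusion are vacuous: [HD] is
       then [False]. *)
    try tauto.
  all: try (apply IHderivable; apply HG; simpl; tauto).
  (* For implications the goal is itself a derivability, so the premise's derivation is used instead
     of its induction hypothesis, with [X] then replaced by [⊤]. *)
  - apply (sreaches_top_plug_top V X HX Hole); apply RImp_R; assumption.
  - apply (sreaches_top_plug_top V X HX Hole); apply LImp_R; assumption.
  - destruct HD; [apply IHderivable1 | apply IHderivable2]; apply HG; assumption.
  - apply IHderivable2, HG, IHderivable1; assumption.
Qed.

Theorem theorem8 (V : Type) (A B : formula V) :
  $⊤ ⇒ A ∨' B -> ($⊤ ⇒ A) \/ ($⊤ ⇒ B).
Proof.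
  intros H.
  destruct (reaches_top_sound V _ _ H I) as [HA | HB];
    [left | right]; apply reaches_top_derivable; assumption.
Qed.
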